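(* Let $\Gamma$ be a group that is nilpotent of class $\le n$, let $S\subseteq\Gamma\setminus\{\mathbb{I}\}$ be a generating set, $G:=\mathrm{Cay}(\Gamma,S)$, and let $r\ge 2^{n+2}$ be an integer. Let $h\in S$ be such that $\{\mathbb{I},h\}$ is an $r$-local $2$-separator of $G$, and suppose that $G$ has no $r$-local cutvertex. If $h$ is not an involution, then $S\subseteq\{h^{\pm1},h^{\pm2}\}$.
   Context: Generating sets are closed under inverses; $\mathrm{Cay}(\Gamma,S)$ is the simple graph on $\Gamma$ with edges $\{g,gs\}$. $a\equiv b$ means $a=b$ or $a=b^{-1}$; $\Gamma$ is nilpotent of class $\le n$ if $[g,h]_n=\mathbb{I}$ for all $g\not\equiv h$, where $[g,h]_1=gh^{-1}g^{-1}h$ and $[g,h]_n$ is the reduced form of $g[g,h]_{n-1}^{-1}g^{-1}[g,h]_{n-1}$. Ball $B_r(v)$: subgraph of all vertices and edges on closed walks of length $\le r$ through $v$; $v$ is an $r$-local cutvertex if $B_r(v)-v$ is disconnected. For $X=\{v_0,v_1\}$, $N(X)$ is the set of vertices outside $X$ adjacent to $X$; the connectivity graph $C_r(v_0,v_1)$ has vertex set $N(X)$, $a,b$ adjacent if for some $i$ they lie in the same component of $B_r(v_i)-v_0-v_1$; $X$ is an $r$-local $2$-separator if $C_r(v_0,v_1)$ is disconnected and $d_G(v_0,v_1)\le r/2$. *)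

(* Defs.v *)
From Stdlib Require Import Arith Relations.

Record group := Group {
  carrier :> Type;
  mul : carrier -> carrier -> carrier;
  inv : carrier -> carrier;
  one : carrier;
  mulA : forall x y z, mul x (mul y z) = mul (mul x y) z;
  mul1g : forall x, mul one x = x;
  mulg1 : forall x, mul x one = x;
  mulVg : forall x, mul (inv x) x = one;
  mulgV : forall x, mul x (inv x) = one
}.

Arguments mul {g}.
Arguments inv {g}.
Arguments one {g}.

Section Defs.
Variable Gm : group.

Definition equiv_pm (a b : Gm) : Prop := a = b \/ a = inv b.

(** [comm_iter g h k] is [g,h]_{k+1}:
    [g,h]_1 = g h^-1 g^-1 h,
    [g,h]_{k+1} = g [g,h]_k^-1 g^-1 [g,h]_k. *)
Fixpoint comm_iter (g h : Gm) (k : nat) : Gm :=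
  match k with
  | 0 => mul g (mul (inv h) (mul (inv g) h))
  | S k' => let c := comm_iter g h k' in mul g (mul (inv c) (mul (inv g) c))
  end.

(** [g,h]_n for n >= 1 *)
Definition commn (g h : Gm) (n : nat) : Gm := comm_iter g h (n - 1).

Definition nilpotent_le (n : nat) : Prop :=
  forall g h : Gm, ~ equiv_pm g h -> commn g h n = one.

Variable Sg : Gm -> Prop.

Definition inv_closed : Prop := forall s, Sg s -> Sg (inv s).

Inductive gen : Gm -> Prop :=
  | gen_one : gen one
  | gen_mul : forall g s, gen g -> Sg s -> gen (mul g s).

Definition generating : Prop := forall g, gen g.

Definition adj (x y : Gm) : Prop :=
  (exists s, Sg s /\ y = mul x s) \/ (exists s, Sg s /\ x = mul y s).

Definition walk (f : nat -> Gm) (k : nat) : Prop :=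
  forall i, i < k -> adj (f i) (f (S i)).

(** closed walk of length <= r through v (rotated to start at v) *)
Definition closed_walk_at (r : nat) (v : Gm) (f : nat -> Gm) (k : nat) : Prop :=
  walk f k /\ k <= r /\ f 0 = v /\ f k = v.

Definition ball_vertex (r : nat) (v u : Gm) : Prop :=
  exists f k, closed_walk_at r v f k /\ exists i, i <= k /\ f i = u.

Definition ball_edge (r : nat) (v a b : Gm) : Prop :=
  exists f k, closed_walk_at r v f k /\
    exists i, i < k /\ ((f i = a /\ f (S i) = b) \/ (f i = b /\ f (S i) = a)).

Definition ball_conn (r : nat) (v : Gm) (X : Gm -> Prop) (a b : Gm) : Prop :=
  ball_vertex r v a /\ ~ X a /\ ball_vertex r v b /\ ~ X b /\
  clos_refl_trans Gm (fun x y => ball_edge r v x y /\ ~ X x /\ ~ X y) a b.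

Definition local_cutvertex (r : nat) (v : Gm) : Prop :=
  exists a b, ball_vertex r v a /\ a <> v /\ ball_vertex r v b /\ b <> v /\
    ~ ball_conn r v (fun x => x = v) a b.

Definition nbhd2 (v0 v1 u : Gm) : Prop :=
  u <> v0 /\ u <> v1 /\ (adj u v0 \/ adj u v1).

Definition conn_graph_adj (r : nat) (v0 v1 a b : Gm) : Prop :=
  nbhd2 v0 v1 a /\ nbhd2 v0 v1 b /\
  (ball_conn r v0 (fun x => x = v0 \/ x = v1) a b \/
   ball_conn r v1 (fun x => x = v0 \/ x = v1) a b).

Definition dist_le_half (r : nat) (v0 v1 : Gm) : Prop :=
  exists f k, walk f k /\ f 0 = v0 /\ f k = v1 /\ 2 * k <= r.

Definition local_2sep (r : nat) (v0 v1 : Gm) : Prop :=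
  (exists a b, nbhd2 v0 v1 a /\ nbhd2 v0 v1 b /\
     ~ clos_refl_trans Gm (conn_graph_adj r v0 v1) a b) /\
  dist_le_half r v0 v1.

End Defs.

(* Main.v *)
(** Let [s] be a generator outside [{h^±1, h^±2}]; then [C_r(1,h)] is connected.
    Cancelling turns the Engel relation [[h,s]_n = 1] into a closed walk of
    length [2^(n+1)] that alternates between [h^±1] and [s^±1], the signs of [s]
    alternating.  A shortest subword of length at least two with value in
    [{1, h, h^-1}] closes up, by at most one edge labelled [h], to a simple cycle
    without chords labelled [h].  Such a cycle meets a translate [{v, vh}] only
    in one vertex or one edge, so the two neighbours through which it leaves
    [{v, vh}] are adjacent in the connectivity graph.  Unless [s] commutes with
    [h], where the commutator square does the job, a cycle of this kind reads
    [h s] or [s^-1 h^-1] somewhere, which joins [vs] to [vh^-1], and [vhs] to one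
    of [vs], [vs^-1], [vh^-1].  Taking [(v,h)] to be [(1,h)] and [(h,h^-1)] joins
    every neighbour of [{1,h}] to [h^-1]; the possible neighbours [h^-2] and
    [h^3] are covered by triangles. *)

Require Import Defs.
From Stdlib Require Import Arith Relations List Lia Classical.
Import ListNotations.

(** * Group identities and normalisation by rewriting *)

Section GroupLaws.
Variable Gm : group.
Implicit Types x y z : Gm.

Lemma mulKg x y : mul (inv x) (mul x y) = y.
Proof. now rewrite mulA, mulVg, mul1g. Qed.

Lemma mulKVg x y : mul x (mul (inv x) y) = y.
Proof. now rewrite mulA, mulgV, mul1g. Qed.

Lemma mul_left_inj x y z : mul x y = mul x z -> y = z.
Proof. intro E. now rewrite <- (mulKg x y), E, mulKg. Qed.

Lemma mul_right_inj x y z : mul y x = mul z x -> y = z.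
Proof.
  intro E. apply (f_equal (fun t => mul t (inv x))) in E.
  now rewrite <- !mulA, !mulgV, !mulg1 in E.
Qed.

Lemma inv_unique x y : mul x y = one -> y = inv x.
Proof. intro E. apply (mul_left_inj x). now rewrite E, mulgV. Qed.

Lemma invgK x : inv (inv x) = x.
Proof. symmetry. apply inv_unique, mulVg. Qed.

Lemma invMg x y : inv (mul x y) = mul (inv y) (inv x).
Proof.
  symmetry. apply inv_unique.
  now rewrite <- mulA, (mulA _ y), mulgV, mul1g, mulgV.
Qed.

Lemma invg1 : inv (@one Gm) = one.
Proof. symmetry. apply inv_unique, mul1g. Qed.

Lemma mul_eq_movel x y z : mul x y = z -> y = mul (inv x) z.
Proof. intros <-. now rewrite mulKg. Qed.

Lemma mul_eq_mover x y z : mul x y = z -> x = mul z (inv y).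
Proof. intros <-. now rewrite <- mulA, mulgV, mulg1. Qed.

End GroupLaws.

#[local] Hint Rewrite mulVg mulgV mul1g mulg1 mulKg mulKVg invgK invMg invg1
  : group_db.

Ltac gsimpl := autorewrite with group_db; rewrite <- ?mulA;
  autorewrite with group_db; rewrite <- ?mulA; autorewrite with group_db.
Ltac gsimpl_in H := autorewrite with group_db in H; rewrite <- ?mulA in H;
  autorewrite with group_db in H; rewrite <- ?mulA in H;
  autorewrite with group_db in H.

(** * Connectivity inside punctured local balls *)

Section Balls.
Variables (Gm : group) (Sg : Gm -> Prop) (r : nat).

Lemma ball_edge_sym v x y : ball_edge Gm Sg r v x y -> ball_edge Gm Sg r v y x.
Proof.
  intros (f & k & C & i & Hi & E). exists f, k. split; [exact C|].
  exists i. tauto.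
Qed.

Lemma clos_rt_sym (A : Type) (R : relation A) :
  (forall x y, R x y -> R y x) ->
  forall x y, clos_refl_trans A R x y -> clos_refl_trans A R y x.
Proof.
  intros HR x y H. induction H.
  - apply rt_step; auto.
  - apply rt_refl.
  - eapply rt_trans; eauto.
Qed.

Lemma ball_conn_sym v X a b :
  ball_conn Gm Sg r v X a b -> ball_conn Gm Sg r v X b a.
Proof.
  intros (Ba & Xa & Bb & Xb & H). repeat split; auto.
  apply clos_rt_sym; [|exact H].
  intros x y (E & Hx & Hy). split; [now apply ball_edge_sym|auto].
Qed.

Lemma ball_conn_ext v (X Y : Gm -> Prop) a b :
  (forall x, X x <-> Y x) ->
  ball_conn Gm Sg r v X a b -> ball_conn Gm Sg r v Y a b.
Proof.
  intros E (Ba & Xa & Bb & Xb & H).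
  repeat split; auto; try (rewrite <- E; assumption).
  clear Ba Xa Bb Xb. induction H as [x y (Hxy & Hx & Hy)| |].
  - apply rt_step. rewrite E in Hx, Hy. auto.
  - apply rt_refl.
  - eapply rt_trans; eauto.
Qed.

Lemma conn_graph_adj_sym v0 v1 a b :
  conn_graph_adj Gm Sg r v0 v1 a b -> conn_graph_adj Gm Sg r v0 v1 b a.
Proof.
  intros (Na & Nb & [H|H]); repeat split; try apply Na; try apply Nb;
    [left|right]; now apply ball_conn_sym.
Qed.

(** The edges of a short closed walk through [v] are ball edges by definition, so connectivity in a
    punctured ball is shown by exhibiting a stretch of such a walk that misses [X]. *)
Lemma closed_walk_conn v X f k a b x y :
  closed_walk_at Gm Sg r v f k -> f a = x -> f b = y -> a <= b <= k ->
  (forall i, a <= i <= b -> ~ X (f i)) ->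
  ball_conn Gm Sg r v X x y.
Proof.
  intros C <- <- [Hab Hbk] HX.
  assert (V : forall i, i <= k -> ball_vertex Gm Sg r v (f i)).
  { intros i Hi. exists f, k. split; [exact C|]. exists i. auto. }
  assert (P : forall j, a <= j <= b -> clos_refl_trans Gm
    (fun x y => ball_edge Gm Sg r v x y /\ ~ X x /\ ~ X y) (f a) (f j)).
  { intros j [Hj Hjb]. induction Hj as [|j Hj IH]; [apply rt_refl|].
    eapply rt_trans; [apply IH; lia|]. apply rt_step.
    repeat split; try (apply HX; lia).
    exists f, k. split; [exact C|]. exists j. split; [lia|auto]. }
  repeat split; try (apply V; lia); try (apply HX; lia). apply P. lia.
Qed.

End Balls.

(** * Words in two generators *)

(* The boolean is the sign of the exponent: [Lh false] stands for [h^-1]. *)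
Inductive letter := Lh (b : bool) | Ls (b : bool).

Definition linv (a : letter) : letter :=
  match a with Lh b => Lh (negb b) | Ls b => Ls (negb b) end.

Definition winv (l : list letter) : list letter := rev (map linv l).

Lemma winv_app l1 l2 : winv (l1 ++ l2) = winv l2 ++ winv l1.
Proof. unfold winv. now rewrite map_app, rev_app_distr. Qed.

Lemma length_winv l : length (winv l) = length l.
Proof. unfold winv. now rewrite length_rev, length_map. Qed.

Lemma winvK l : winv (winv l) = l.
Proof.
  unfold winv. rewrite map_rev, rev_involutive, map_map.
  rewrite <- (map_id l) at 2. apply map_ext. now intros [[]|[]].
Qed.

Section Words.
Variables (Gm : group) (h s : Gm).

Definition sgn (x : Gm) (b : bool) : Gm := if b then x else inv x.

Definition ev (a : letter) : Gm :=
  match a with Lh b => sgn h b | Ls b => sgn s b end.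

Fixpoint eval (l : list letter) : Gm :=
  match l with [] => one | a :: l => mul (ev a) (eval l) end.

Lemma eval_app l1 l2 : eval (l1 ++ l2) = mul (eval l1) (eval l2).
Proof.
  induction l1 as [|a l1 IH]; simpl; [now rewrite mul1g|].
  now rewrite IH, mulA.
Qed.

Lemma ev_linv a : ev (linv a) = inv (ev a).
Proof. destruct a as [[]|[]]; simpl; now rewrite ?invgK. Qed.

Lemma eval_winv l : eval (winv l) = inv (eval l).
Proof.
  induction l as [|a l IH]; [symmetry; apply invg1|].
  change (a :: l) with ([a] ++ l) at 1. rewrite winv_app, eval_app, IH.
  simpl. now rewrite ev_linv, mulg1, invMg.
Qed.

(** A path labelled by a word with one of these values has ends that coincide or differ by a step
    [h] or [h^-1]. *)
Definition h_unit (x : Gm) : Prop := x = one \/ x = h \/ x = inv h.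

Lemma h_unit_inv x : h_unit (inv x) -> h_unit x.
Proof.
  unfold h_unit. intros [E|[E|E]]; apply (f_equal inv) in E;
    rewrite invgK in E; subst; rewrite ?invgK, ?invg1; auto.
Qed.

(* The closed walk spelled by [W] is a simple cycle none of whose chords is
   labelled by [h]. *)
Definition chordless (W : list letter) : Prop :=
  eval W = one /\
  forall l1 l2 l3, W = l1 ++ l2 ++ l3 -> 2 <= length l2 ->
    2 <= length l1 + length l3 -> ~ h_unit (eval l2).

Lemma eval_cyclic l1 l2 : eval (l1 ++ l2) = one -> eval (l2 ++ l1) = one.
Proof.
  rewrite !eval_app. intro E. apply inv_unique in E. rewrite E.
  apply mulVg.
Qed.

(** A subword of [b ++ a] straddling the seam has a subword of [a ++ b] as complement, with inverse
    value because the whole word is trivial. The length bounds in [chordless] are symmetric in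
    subword and complement, so they carry over. *)
Lemma chordless_rot a b : chordless (a ++ b) -> chordless (b ++ a).
Proof.
  intros [E C]. split; [now apply eval_cyclic|].
  intros l1 l2 l3 H H2 H13 U.
  apply app_eq_app in H as [l [[-> H]|[-> ->]]].
  - apply app_eq_app in H as [m [[-> ->]|[-> ->]]].
    + apply (C m (l3 ++ l1) l); rewrite ?length_app, <- ?app_assoc in *;
        try lia; auto.
      assert (F : eval ((l3 ++ l1) ++ l ++ m) = one).
      { rewrite app_assoc. apply eval_cyclic. now rewrite <- !app_assoc in *. }
      rewrite eval_app in F. apply inv_unique in F. rewrite F in U.
      now apply h_unit_inv.
    + apply (C (a ++ l1) l2 m); rewrite ?length_app, <- ?app_assoc in *;
        try lia; auto.
  - apply (C l l2 (l3 ++ b)); rewrite ?length_app, <- ?app_assoc in *;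
      try lia; auto.
Qed.

Lemma chordless_winv W : chordless W -> chordless (winv W).
Proof.
  intros [E C]. split; [rewrite eval_winv, E; apply invg1|].
  intros l1 l2 l3 H H2 H13 U.
  apply (f_equal winv) in H. rewrite winvK, !winv_app, <- app_assoc in H.
  refine (C _ _ _ H _ _ _); rewrite ?length_winv; try lia.
  rewrite eval_winv. apply h_unit_inv. now rewrite invgK.
Qed.

Lemma eval_belast W b :
  eval (W ++ [b]) = one -> eval (firstn (length W) (W ++ [b])) = inv (ev b).
Proof.
  intro E. rewrite firstn_app, Nat.sub_diag, firstn_all, app_nil_r.
  rewrite eval_app in E. simpl in E. rewrite mulg1 in E.
  apply inv_unique in E. now rewrite E, invgK.
Qed.

(** The prefix of length [length W] is treated apart because its complement is a single letter,
    below the bound in [chordless]. *)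
Lemma chordless_prefix W b i :
  chordless (W ++ [b]) -> 2 <= i <= length W ->
  eval (firstn i (W ++ [b])) = inv (ev b) \/
  ~ h_unit (eval (firstn i (W ++ [b]))).
Proof.
  intros [E C] Hi. destruct (Nat.eq_dec i (length W)) as [->|Ne].
  - left. now apply eval_belast.
  - right. apply (C [] _ (skipn i (W ++ [b]))).
    + simpl. now rewrite firstn_skipn.
    + rewrite length_firstn, length_app. simpl. lia.
    + rewrite length_skipn, length_app. simpl. lia.
Qed.

(** [h s] and [s^-1 h^-1] are one corner of a cycle, traversed in the two directions. *)
Definition turn (a b : letter) : bool :=
  match a, b with
  | Lh true, Ls true | Ls false, Lh false => true
  | _, _ => false
  end.

Fixpoint has_turn (l : list letter) : bool :=
  match l with
  | a :: ((b :: _) as l') => turn a b || has_turn l'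
  | _ => false
  end.

Lemma has_turnP l : has_turn l = true ->
  exists l1 l2, l = l1 ++ Lh true :: Ls true :: l2 \/
                l = l1 ++ Ls false :: Lh false :: l2.
Proof.
  induction l as [|a l IH]; [discriminate|].
  destruct l as [|b l]; [discriminate|].
  intro H. change (orb (turn a b) (has_turn (b :: l)) = true) in H.
  apply Bool.orb_true_iff in H as [H|H].
  - exists [], l. destruct a as [[]|[]], b as [[]|[]]; try discriminate; auto.
  - destruct (IH H) as (l1 & l2 & [E|E]); exists (a :: l1), l2; rewrite E; auto.
Qed.

(* Reading positions of the cyclic pattern [h^± s^-1 h^± s]; [Q0] and [Q1] are
   the positions before and after the first [h^±], and so on. *)
Inductive state := Q0 | Q1 | Q2 | Q3.

Definition step (q : state) (a : letter) : option state :=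
  match q, a with
  | Q0, Lh _ => Some Q1
  | Q1, Ls false => Some Q2
  | Q2, Lh _ => Some Q3
  | Q3, Ls true => Some Q0
  | _, _ => None
  end.

Fixpoint run (q : state) (l : list letter) : option state :=
  match l with
  | [] => Some q
  | a :: l => match step q a with Some q' => run q' l | None => None end
  end.

Lemma run_app q l1 l2 :
  run q (l1 ++ l2) = match run q l1 with Some q' => run q' l2 | None => None end.
Proof.
  revert q; induction l1 as [|a l1 IH]; intro q; simpl; [reflexivity|].
  destruct (step q a); auto.
Qed.

(** Inverting a word preserves the cyclic pattern; this is the induced map on positions. *)
Definition qinv (q : state) : state :=
  match q with Q0 => Q1 | Q1 => Q0 | Q2 => Q3 | Q3 => Q2 end.

Lemma run_winv q l q' :
  run q l = Some q' -> run (qinv q') (winv l) = Some (qinv q).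
Proof.
  revert q; induction l as [|a l IH]; simpl; intros q H.
  - now injection H as ->.
  - destruct (step q a) as [p|] eqn:Hp; [|discriminate].
    change (a :: l) with ([a] ++ l). rewrite winv_app, run_app, (IH _ H).
    destruct q, a as [[]|[]]; simpl in *; try discriminate;
      now injection Hp as <-.
Qed.

(** With [c = h y], the recursion [h c^-1 h^-1 c] cancels to [h y^-1 h^-1 y], which keeps the
    pattern and doubles the length of [h y]. *)
Lemma comm_iter_word k : exists y,
  comm_iter Gm h s k = mul h (eval y) /\ run Q1 y = Some Q0 /\
  length y + 1 = 2 ^ (k + 2).
Proof.
  induction k as [|k (y & E & R & L)].
  - exists [Ls false; Lh false; Ls true]. simpl. now rewrite mulg1.
  - exists (winv y ++ Lh false :: y). repeat split.
    + simpl comm_iter. rewrite E, eval_app, eval_winv. simpl. now gsimpl.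
    + apply run_winv in R as R'. simpl in R'. rewrite run_app, R'. exact R.
    + rewrite length_app, length_winv. simpl in *. lia.
Qed.

Definition h_minimal (l : list letter) : Prop :=
  2 <= length l /\ h_unit (eval l) /\
  forall l1 l2 l3, l = l1 ++ l2 ++ l3 -> 2 <= length l2 ->
    1 <= length l1 + length l3 -> ~ h_unit (eval l2).

(** Descent on the length: a subword still follows the pattern, read from another position. *)
Lemma h_minimal_subword q l q' :
  run q l = Some q' -> 2 <= length l -> h_unit (eval l) ->
  exists p m p', run p m = Some p' /\ length m <= length l /\ h_minimal m.
Proof.
  remember (length l) as k eqn:Hk. revert q l q' Hk.
  induction k as [k IH] using lt_wf_ind. intros q l q' -> R L U.
  destruct (classic (exists l1 l2 l3, l = l1 ++ l2 ++ l3 /\ 2 <= length l2 /\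
    1 <= length l1 + length l3 /\ h_unit (eval l2)))
    as [(l1 & l2 & l3 & -> & L2 & L13 & U2)|N].
  - rewrite run_app in R. rewrite !length_app in *. revert R.
    destruct (run q l1) as [p|]; [|discriminate].
    rewrite run_app.
    destruct (run p l2) as [p'|] eqn:R2; [|discriminate]. intros _.
    destruct (IH (length l2) ltac:(lia) p l2 p' eq_refl R2 L2 U2)
      as (x & m & x' & Rm & Lm & M).
    exists x, m, x'. repeat split; try apply M; auto. lia.
  - exists q, l, q'. repeat split; auto.
    intros l1 l2 l3 E L2 L13 U2. apply N. now exists l1, l2, l3.
Qed.

(** A subword ending in the closing letter is traded for its complement, a proper prefix of [l] with
    inverse value; the other subwords to be excluded lie properly inside [l]. *)
Lemma h_minimal_closure l c :
  h_minimal l -> c = [] \/ (exists b, c = [Lh b]) -> eval (l ++ c) = one ->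
  chordless (l ++ c).
Proof.
  intros (L & U & M) Hc E. split; [exact E|].
  intros l1 l2 l3 H L2 L13 U2.
  destruct Hc as [->|[b ->]].
  - rewrite app_nil_r in H. apply (M _ _ _ H); auto; lia.
  - destruct l3 as [|x l3] using rev_ind.
    + rewrite app_nil_r in H. simpl in L13.
      destruct l2 as [|x l2 _] using rev_ind; [simpl in L2; lia|].
      rewrite app_assoc in H. apply app_inj_tail in H as [-> <-].
      apply (M [] l1 l2); auto; rewrite ?length_app in *; simpl in *; try lia.
      rewrite <- app_assoc, eval_app in E. apply inv_unique in E.
      rewrite E in U2. now apply h_unit_inv.
    + clear IHl3. rewrite !app_assoc in H. apply app_inj_tail in H as [-> <-].
      rewrite <- app_assoc in M. rewrite length_app in L13. simpl in L13.
      apply (M _ _ _ eq_refl L2); auto. lia.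
Qed.

Hypotheses (h1 : h <> one) (nc : mul s h <> mul h s).

(* A word following the pattern without a turn has length at most five, so only
   finitely many words have to be closed up by hand. *)
Lemma h_minimal_turn q l q' :
  run q l = Some q' -> h_minimal l ->
  exists c x y, (c = [] \/ exists b, c = [Lh b]) /\ eval (l ++ c) = one /\
    l ++ c = x ++ y /\ has_turn (y ++ x) = true.
Proof.
  intros R (L & U & M).
  assert (K : forall c, (c = [] /\ eval l = one) \/
      (c = [Lh false] /\ eval l = h) \/ (c = [Lh true] /\ eval l = inv h) ->
      exists x y, l ++ c = x ++ y /\ has_turn (y ++ x) = true).
  { clear U. intros c Hc.
    destruct (has_turn l) eqn:T.
    { exists l, c. split; [reflexivity|].
      destruct l as [|a l]; [discriminate|].
      destruct Hc as [[-> _]|[[-> _]|[-> _]]]; [exact T| |];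
        (etransitivity; [apply (f_equal (orb _) T)|apply Bool.orb_true_r]). }
    (* Whatever its middle sign, [s^-1 h^± s] contains a turn. Hence the longest word without one is
       [h^-1 s h^± s^-1 h], and six case distinctions exhaust the list. *)
    destruct q;
      do 6 (try (destruct l as [|[[]|[]] l]; simpl in R, T; try discriminate));
      try (simpl in L; lia); clear R T L;
      destruct Hc as [[-> U]|[[-> U]|[-> U]]];
      (* The turn is sought with the closing letter moved to the front, in the word as it stands, or
         with the first letter moved to the end. In all other cases the value of [l] is
         contradictory. *)
      try match goal with |- exists x y, (?a :: ?l) ++ ?c = _ /\ _ =>
        first [ exists (a :: l), c; split; reflexivity
              | exists ((a :: l) ++ c), []; split; reflexivity
              | exists [a], (l ++ c); split; reflexivity ]
      end;
      exfalso; simpl in U;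
      repeat match type of U with
        | mul h _ = _ => apply mul_eq_movel in U
        | mul (inv h) _ = _ => apply mul_eq_movel in U
        | mul _ h = _ => apply mul_eq_mover in U
        | mul _ (inv h) = _ => apply mul_eq_mover in U
        | inv s = _ => apply (f_equal inv) in U
        | _ => progress (gsimpl_in U)
        end.
    all: try (apply nc; rewrite U; gsimpl; reflexivity).
    all: try match type of U with mul _ (mul _ (mul _ h)) = _ =>
      rewrite !mulA in U; apply mul_eq_mover in U; gsimpl_in U end.
    (* A conjugate of [h] or [h^-1] is trivial only if [h] is. *)
    all: try match type of U with mul s (mul ?x (inv s)) = one =>
      apply mul_eq_movel, mul_eq_mover in U; gsimpl_in U;
      first [now apply h1 | apply (f_equal inv) in U; gsimpl_in U; now apply h1]
      end.
    (* The words left are [h^-1 s h^± s^-1 h]; their inner conjugate has an [h_unit] value, against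
       minimality. *)
    all: apply (M [Lh false] [Ls true; _; Ls false] [Lh true] eq_refl);
      simpl; try lia; rewrite ?mulg1, U; unfold h_unit; auto. }
  destruct U as [U|[U|U]];
    [destruct (K []) as (x & y & Hx & Hy)
    |destruct (K [Lh false]) as (x & y & Hx & Hy)
    |destruct (K [Lh true]) as (x & y & Hx & Hy)]; auto;
    [exists []|exists [Lh false]|exists [Lh true]]; exists x, y;
    rewrite eval_app, U; repeat split; eauto; simpl; now gsimpl.
Qed.

End Words.

Lemma firstn_S_app (A : Type) (l : list A) i : i < length l ->
  exists a, firstn (S i) l = firstn i l ++ [a].
Proof.
  revert i; induction l as [|b l IH]; simpl; intros i Hi; [lia|].
  destruct i as [|i]; [now exists b|].
  destruct (IH i) as [a E]; [lia|]. exists a. simpl in *. now rewrite E.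
Qed.

(** * Cycles through an edge labelled [h] *)

Section Turns.
Variables (Gm : group) (Sg : Gm -> Prop) (r : nat) (h s v : Gm).
Hypotheses (Sinv : inv_closed Gm Sg) (Sh : Sg h) (Ss : Sg s).
Hypotheses (h1 : h <> one) (hh1 : mul h h <> one) (s1 : s <> one)
  (sh : s <> h) (shV : s <> inv h).

Let X := fun x => x = v \/ x = mul v h.

Lemma inX x : X (mul v x) -> x = one \/ x = h.
Proof.
  intros [E|E]; [left|right]; apply (mul_left_inj _ v); rewrite ?mulg1; auto.
Qed.

Lemma word_closed_walk W : length W <= r -> eval Gm h s W = one ->
  closed_walk_at Gm Sg r v (fun i => mul v (eval Gm h s (firstn i W)))
    (length W).
Proof.
  intros L E. repeat split; auto.
  - intros i Hi. destruct (firstn_S_app _ W i Hi) as [a ->].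
    left. exists (ev Gm h s a). split.
    + destruct a as [[]|[]]; simpl; auto.
    + rewrite eval_app. simpl. now rewrite mulg1, mulA.
  - simpl. apply mulg1.
  - rewrite firstn_all, E. apply mulg1.
Qed.

Definition linked : Prop :=
  ball_conn Gm Sg r v X (mul v s) (mul v (inv h)) /\
  exists p, (p = s \/ p = inv s \/ p = inv h) /\
    ball_conn Gm Sg r v X (mul v (mul h s)) (mul v p).

Lemma hV_neq_h : inv h <> h.
Proof. intro E. apply hh1. rewrite <- E at 1. apply mulVg. Qed.

(** The cycle reads [s W h] from [v]. Strictly between its two visits to [v] it also misses [v h]:
    the first and last prefix values are computed directly, the others are covered by
    [chordless]. *)
Lemma chordless_turn_s W :
  chordless Gm h s (Ls true :: W ++ [Lh true]) -> length W + 2 <= r ->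
  ball_conn Gm Sg r v X (mul v s) (mul v (inv h)).
Proof.
  intros C L.
  set (V := Ls true :: W) in *. change (chordless Gm h s (V ++ [Lh true])) in C.
  assert (LV : length (V ++ [Lh true]) = S (S (length W))).
  { unfold V. rewrite length_app. simpl. lia. }
  assert (CW := word_closed_walk _ ltac:(rewrite LV; lia) (proj1 C)).
  assert (E1 : eval Gm h s (firstn 1 (V ++ [Lh true])) = s) by apply mulg1.
  assert (E2 : eval Gm h s (firstn (S (length W)) (V ++ [Lh true])) = inv h)
    by exact (eval_belast _ _ _ V _ (proj1 C)).
  apply (closed_walk_conn _ _ _ _ _ _ _ 1 (S (length W)) _ _ CW
    (f_equal (mul v) E1) (f_equal (mul v) E2)); [lia|].
  intros i Hi HX. apply inX in HX.
  destruct (Nat.eq_dec i 1) as [->|Hi1].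
  - rewrite E1 in HX. destruct HX; auto.
  - destruct (chordless_prefix _ _ _ V (Lh true) i C) as [E|N].
    + simpl. lia.
    + rewrite E in HX. simpl in HX. destruct HX as [F|F].
      * apply h1. now rewrite <- (invgK _ h), F, invg1.
      * now apply hV_neq_h.
    + apply N. unfold h_unit. tauto.
Qed.

(** After crossing the edge from [v] to [v h], the cycle leads from [v h s] to [v p^-1]; with
    [p = h^-1] it would end at the forbidden vertex [v h]. *)
Lemma chordless_edge_s W p :
  chordless Gm h s (Lh true :: Ls true :: W ++ [p]) -> length W + 3 <= r ->
  p <> Lh false ->
  ball_conn Gm Sg r v X (mul v (mul h s)) (mul v (inv (ev Gm h s p))).
Proof.
  intros C L Hp.
  set (V := Lh true :: Ls true :: W) in *.
  change (chordless Gm h s (V ++ [p])) in C.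
  assert (LV : length (V ++ [p]) = S (S (S (length W)))).
  { unfold V. rewrite length_app. simpl. lia. }
  assert (CW := word_closed_walk _ ltac:(rewrite LV; lia) (proj1 C)).
  assert (E1 : eval Gm h s (firstn 2 (V ++ [p])) = mul h s).
  { simpl. now rewrite mulg1. }
  assert (E2 : eval Gm h s (firstn (S (S (length W))) (V ++ [p]))
    = inv (ev Gm h s p)) by exact (eval_belast _ _ _ V _ (proj1 C)).
  apply (closed_walk_conn _ _ _ _ _ _ _ 2 (S (S (length W))) _ _ CW
    (f_equal (mul v) E1) (f_equal (mul v) E2)); [lia|].
  intros i Hi HX. apply inX in HX.
  destruct (chordless_prefix _ _ _ V p i C) as [E|N].
  - simpl. lia.
  - rewrite E in HX. destruct p as [[]|[]]; simpl in HX; try (now apply Hp);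
      rewrite ?invgK in HX; destruct HX as [F|F]; auto;
      try (now apply hV_neq_h); try (apply (f_equal inv) in F;
        rewrite invgK, ?invg1 in F; auto).
  - apply N. unfold h_unit. tauto.
Qed.

(** Inverting the cycle turns [s^-1 h^-1] into [h s]. Rotating it to start with [s], respectively
    with [h s], gives the two halves of [linked]. *)
Lemma chordless_turn_linked W : chordless Gm h s W -> length W <= r ->
  has_turn W = true -> linked.
Proof.
  intros C L T.
  assert (exists l1 l2, chordless Gm h s (l1 ++ Lh true :: Ls true :: l2) /\
    length l1 + length l2 + 2 <= r) as (l1 & l2 & C' & L').
  { destruct (has_turnP _ T) as (l1 & l2 & [->| ->]).
    - exists l1, l2. rewrite length_app in L. simpl in L. split; [auto|lia].
    - exists (winv l2), (winv l1). apply chordless_winv in C.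
      rewrite length_app in L. simpl in L. rewrite !length_winv.
      split; [|lia].
      change (Ls false :: Lh false :: l2) with ([Ls false; Lh false] ++ l2) in C.
      rewrite !winv_app, <- app_assoc in C. exact C. }
  clear C L T W. split.
  - apply (chordless_turn_s (l2 ++ l1)); [|rewrite length_app; lia].
    change (l1 ++ Lh true :: Ls true :: l2)
      with (l1 ++ [Lh true] ++ Ls true :: l2) in C'.
    rewrite app_assoc in C'. apply chordless_rot in C'.
    simpl in C'. now rewrite app_assoc in C'.
  - apply chordless_rot in C'. simpl in C'.
    assert (L : length (l2 ++ l1) + 2 <= r) by (rewrite length_app; lia).
    destruct (l2 ++ l1) as [|p W _] using rev_ind.
    { destruct C' as [E _]. simpl in E. rewrite mulg1 in E.
      exfalso. apply shV. now apply inv_unique. }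
    rewrite length_app in L. simpl in L.
    exists (inv (ev Gm h s p)).
    (* Cyclically [p] precedes [h], so [p = h^-1] would create the trivial subword [h^-1 h], or
       force [s = 1] if [W] is empty. *)
    assert (Hp : p <> Lh false).
    { intros ->. destruct W as [|a W].
      - destruct C' as [E _]. simpl in E. rewrite mulg1 in E.
        apply s1, (mul_left_inj _ h), (mul_right_inj _ (inv h)).
        rewrite mulg1, mulgV, <- mulA. exact E.
      - change (chordless Gm h s
          ((Lh true :: Ls true :: a :: W) ++ [Lh false])) in C'.
        apply chordless_rot in C'. destruct C' as [_ C'].
        apply (C' [] [Lh false; Lh true] (Ls true :: a :: W));
          simpl; try lia; auto.
        left. gsimpl. reflexivity. }
    split; [destruct p as [[]|[]]; simpl; rewrite ?invgK; tauto|].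
    apply chordless_edge_s with (W := W); auto; lia.
Qed.

Hypotheses (shh : s <> mul h h) (shhV : s <> inv (mul h h)).

Lemma engel_linked n : 1 <= n -> commn Gm h s n = one -> 2 ^ (n + 2) <= r ->
  linked.
Proof.
  intros Hn E Hr.
  assert (P : 2 * 2 ^ (n + 1) = 2 ^ (n + 2)).
  { replace (n + 2) with (S (n + 1)) by lia. reflexivity. }
  assert (P' : 2 ^ 2 <= 2 ^ (n + 1)) by (apply Nat.pow_le_mono_r; lia).
  simpl (2 ^ 2) in P'.
  destruct (classic (mul s h = mul h s)) as [Co|Nc].
  - rewrite invMg in shhV.
    apply (chordless_turn_linked [Lh true; Ls true; Lh false; Ls false]);
      [|simpl; lia|reflexivity].
    split; [simpl; rewrite mulg1, (mulA _ h s), <- Co; gsimpl; reflexivity|].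
    (* Only two-letter subwords qualify; an [h_unit] value of one would put [s] among [1], [h^±1],
       [h^±2]. *)
    intros l1 l2 l3 F L2 L13.
    assert (LF := f_equal (@length letter) F).
    rewrite !length_app in LF. simpl in LF.
    destruct l2 as [|a [|b [|]]]; simpl in *; try lia.
    rewrite mulg1.
    destruct l1 as [|a1 [|a2 [|]]]; simpl in *; try lia; injection F as;
      subst; simpl; intros [U|[U|U]];
      first [apply mul_eq_mover in U; gsimpl_in U; now auto
            |apply mul_eq_movel in U; gsimpl_in U; now auto
            |apply mul_eq_movel, (f_equal inv) in U; gsimpl_in U; now auto].
  - destruct (comm_iter_word Gm h s (n - 1)) as (y & Ey & Ry & Ly).
    (* The Engel word [h y] is trivial, so [y] has value [h^-1] and contains a minimal subword.
       Since [y] lacks one letter of the Engel word, adding a closing letter stays within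
       [2^(n+1)]. *)
    unfold commn in E. rewrite E in Ey. symmetry in Ey. apply inv_unique in Ey.
    replace (n - 1 + 2) with (n + 1) in Ly by lia.
    destruct (h_minimal_subword Gm h s _ _ _ Ry) as (q & l & q' & Rl & Ll & M).
    { lia. }
    { right; right; exact Ey. }
    destruct (h_minimal_turn Gm h s h1 Nc _ _ _ Rl M)
      as (c & x & z & Hc & El & Exz & T).
    assert (C := h_minimal_closure _ _ _ _ _ M Hc El).
    assert (Lc : length (l ++ c) <= r).
    { rewrite length_app. destruct Hc as [->|[b ->]]; simpl; lia. }
    rewrite Exz in C, Lc. apply (chordless_turn_linked (z ++ x)); auto.
    + now apply chordless_rot.
    + rewrite length_app in *. lia.
Qed.

End Turns.

(** With [h^-2] as second generator, the word [h^-2 h h] spells a triangle through [v]; [h^-2 <> h]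
    keeps [v h^-2] apart from [v h]. *)
Lemma triangle_conn (Gm : group) (Sg : Gm -> Prop) r (h v : Gm) :
  inv_closed Gm Sg -> Sg h -> Sg (inv (mul h h)) ->
  h <> one -> mul h h <> one -> inv (mul h h) <> h -> 3 <= r ->
  ball_conn Gm Sg r v (fun x => x = v \/ x = mul v h)
    (mul v (inv (mul h h))) (mul v (inv h)).
Proof.
  intros Sinv Sh Shh h1 hh1 h3 Hr.
  set (W := [Ls true; Lh true; Lh true]).
  assert (CW := word_closed_walk Gm Sg r h (inv (mul h h)) v Sinv Sh Shh W Hr
    ltac:(simpl; gsimpl; reflexivity)).
  assert (E1 : eval Gm h (inv (mul h h)) (firstn 1 W) = inv (mul h h))
    by apply mulg1.
  assert (E2 : eval Gm h (inv (mul h h)) (firstn 2 W) = inv h)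
    by (simpl; gsimpl; reflexivity).
  apply (closed_walk_conn _ _ _ _ _ _ _ 1 2 _ _ CW
    (f_equal (mul v) E1) (f_equal (mul v) E2)); [simpl; lia|].
  intros i Hi HX. apply inX in HX.
  assert (i = 1 \/ i = 2) as [-> | ->] by lia.
  - rewrite E1 in HX. destruct HX as [F|F]; [|auto].
    apply hh1. rewrite <- (invgK _ (mul h h)), F. apply invg1.
  - rewrite E2 in HX. destruct HX as [F|F].
    + apply h1. rewrite <- (invgK _ h), F. apply invg1.
    + now apply (hV_neq_h Gm h hh1).
Qed.

(** * The connectivity graph of the pair [{1, h}] *)

Section ConnectivityGraph.
Variables (Gm : group) (n : nat) (S : Gm -> Prop) (r : nat) (h : Gm).
Hypotheses (n1 : 1 <= n) (nilp : nilpotent_le Gm n)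
  (S1 : forall s, S s -> s <> one) (Sinv : inv_closed Gm S)
  (Hr : 2 ^ (n + 2) <= r) (Sh : S h) (hh1 : mul h h <> one).

Definition small_power (s : Gm) : Prop :=
  s = h \/ s = inv h \/ s = mul h h \/ s = inv (mul h h).

Lemma small_power_inv s : small_power (inv s) -> small_power s.
Proof.
  unfold small_power. intros [E|[E|[E|E]]]; apply (f_equal inv) in E;
    rewrite !invgK in E; tauto.
Qed.

Let conn := clos_refl_trans Gm (conn_graph_adj Gm S r one h).

Lemma conn_sym x y : conn x y -> conn y x.
Proof. apply clos_rt_sym, conn_graph_adj_sym. Qed.

Lemma nbhd2_one s : S s -> s <> h -> nbhd2 Gm S one h s.
Proof.
  intros Ss sh. repeat split; auto. left. right. exists s.
  now rewrite mul1g.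
Qed.

Lemma nbhd2_h s : S s -> s <> inv h -> nbhd2 Gm S one h (mul h s).
Proof.
  intros Ss sh. repeat split.
  - intro E. now apply sh, inv_unique.
  - intro E. apply (S1 s Ss), (mul_left_inj _ h). now rewrite mulg1.
  - right. right. now exists s.
Qed.

Lemma conn_at_one a b :
  nbhd2 Gm S one h a -> nbhd2 Gm S one h b ->
  ball_conn Gm S r one (fun x => x = one \/ x = mul one h)
    (mul one a) (mul one b) -> conn a b.
Proof.
  intros Na Nb H. apply rt_step. split; [exact Na|split; [exact Nb|left]].
  rewrite !mul1g in H. exact H.
Qed.

(** The separator is written as [{h, h h^-1}], the form that [linked] takes at base point [h] with
    generator [h^-1]. *)
Lemma conn_at_h a b :
  nbhd2 Gm S one h a -> nbhd2 Gm S one h b ->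
  ball_conn Gm S r h (fun x => x = h \/ x = mul h (inv h)) a b -> conn a b.
Proof.
  intros Na Nb H. apply rt_step. split; [exact Na|split; [exact Nb|right]].
  eapply ball_conn_ext; [|exact H]. intro x. rewrite mulgV. tauto.
Qed.

Lemma h_neq_hV : h <> inv h.
Proof. intro E. now apply (hV_neq_h Gm h hh1). Qed.

Lemma S_linked s v : S s -> ~ small_power s -> linked Gm S r h s v.
Proof.
  intros Ss Hs. unfold small_power in Hs.
  apply (engel_linked Gm S r h s v) with (n := n); auto; try tauto.
  apply nilp. intros [E|E]; apply Hs; [auto|].
  right; left. now rewrite E, invgK.
Qed.

Lemma S_linked_dual s v : S s -> ~ small_power s -> linked Gm S r (inv h) s v.
Proof.
  intros Ss Hs. unfold small_power in Hs.
  apply (engel_linked Gm S r (inv h) s v) with (n := n); auto; try tauto.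
  - rewrite <- invMg. intro E. apply hh1.
    now rewrite <- (invgK _ (mul h h)), E, invg1.
  - rewrite invgK. tauto.
  - rewrite <- invMg. tauto.
  - rewrite <- invMg, invgK. tauto.
  - apply nilp. intros [E|E]; apply Hs.
    + auto.
    + left. apply (f_equal inv) in E. now rewrite !invgK in E.
Qed.

Lemma conn_s_hV s : S s -> ~ small_power s -> conn s (inv h).
Proof.
  intros Ss Hs. apply conn_at_one.
  - apply nbhd2_one; auto. intro E; apply Hs; now left.
  - apply nbhd2_one; auto. intro E. now apply h_neq_hV.
  - apply (S_linked s one Ss Hs).
Qed.

Lemma conn_hs_hh s : S s -> ~ small_power s -> conn (mul h s) (mul h h).
Proof.
  intros Ss Hs. apply conn_at_h.
  - apply nbhd2_h; auto. intro E; apply Hs; unfold small_power; auto.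
  - apply nbhd2_h; auto. apply h_neq_hV.
  - destruct (S_linked_dual s h Ss Hs) as [H _].
    now rewrite invgK in H.
Qed.

(** This passes from the neighbours of [h] to those of [1]: the ball around [1] joins [h s] to some
    neighbour [p] of [1], which is [h^-1] or already joined to it. *)
Lemma conn_hh_hV s : S s -> ~ small_power s -> conn (mul h h) (inv h).
Proof.
  intros Ss Hs.
  eapply rt_trans; [apply conn_sym, (conn_hs_hh s Ss Hs)|].
  destruct (S_linked s one Ss Hs) as (_ & p & Hp & H).
  assert (Ns : nbhd2 Gm S one h p).
  { apply nbhd2_one.
    - destruct Hp as [->|[->| ->]]; auto.
    - destruct H as (_ & _ & _ & H & _). intros ->. apply H. now right. }
  eapply rt_trans; [apply (conn_at_one _ p); [|exact Ns|exact H]|].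
  - apply nbhd2_h; auto. intro E; apply Hs; unfold small_power; auto.
  - destruct Hp as [->|[->| ->]].
    + now apply conn_s_hV.
    + apply conn_s_hV; auto. intro F. now apply Hs, small_power_inv.
    + apply rt_refl.
Qed.

Lemma nbhd2_conn s a :
  S s -> ~ small_power s -> nbhd2 Gm S one h a -> conn a (inv h).
Proof.
  intros Ss Hs (a1 & ah & Ha).
  assert (r3 : 3 <= r).
  { assert (2 ^ 2 <= 2 ^ (n + 2)) by (apply Nat.pow_le_mono_r; lia).
    simpl (2 ^ 2) in *. lia. }
  assert (hV : nbhd2 Gm S one h (inv h)).
  { apply nbhd2_one; auto. intro E. now apply h_neq_hV. }
  (* Closure under inverses reduces the four forms of adjacency to [a] in [S] or in [h S]. *)
  assert (S a \/ exists t, S t /\ a = mul h t) as [Sa|(t & St & ->)].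
  { destruct Ha as [[(t & St & E)|(t & St & E)]|[(t & St & E)|(t & St & E)]].
    - left. symmetry in E. apply mul_eq_mover in E. rewrite mul1g in E.
      subst. auto.
    - left. rewrite mul1g in E. now subst.
    - right. exists (inv t). split; [auto|].
      symmetry in E. now apply mul_eq_mover in E.
    - right. now exists t. }
  - destruct (classic (small_power a)) as [[->|[->|[->| ->]]]|Na].
    + easy.
    + apply rt_refl.
    + now apply (conn_hh_hV s).
    (* Here [a = h^-2], joined to [h^-1] by the triangle at [1]. *)
    + apply conn_at_one; [now apply nbhd2_one|exact hV|].
      apply triangle_conn; auto.
    + now apply conn_s_hV.
  - assert (tV : t <> inv h) by (intros ->; apply a1, mulgV).
    destruct (classic (small_power t)) as [[->|[->|[->| ->]]]|Nt].
    + now apply (conn_hh_hV s).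
    + easy.
    (* Here [a = h^3]; the triangle at [h] for the generator [h^-1] joins it to [h^2]. *)
    + eapply rt_trans; [|now apply (conn_hh_hV s)].
      apply conn_at_h; [now apply nbhd2_h|apply nbhd2_h; auto using h_neq_hV|].
      assert (T := triangle_conn Gm S r (inv h) h Sinv (Sinv _ Sh)).
      rewrite <- invMg, !invgK in T. apply T; auto.
    + rewrite invMg, mulKVg. apply rt_refl.
    + eapply rt_trans; [now apply conn_hs_hh|now apply (conn_hh_hV s)].
Qed.

End ConnectivityGraph.

Theorem theorem6p2 (Gm : group) (n : nat) (S : Gm -> Prop) (r : nat) (h : Gm) :
  1 <= n ->
  nilpotent_le Gm n ->
  (forall s, S s -> s <> one) ->
  inv_closed Gm S ->
  generating Gm S ->
  2 ^ (n + 2) <= r ->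
  S h ->
  local_2sep Gm S r one h ->
  (forall v : Gm, ~ local_cutvertex Gm S r v) ->
  mul h h <> one ->
  forall s, S s -> s = h \/ s = inv h \/ s = mul h h \/ s = inv (mul h h).
Proof.
  intros n1 nilp S1 Sinv _ Hr Sh [(a & b & Na & Nb & Nab) _] _ hh1 s Ss.
  apply NNPP. intro Hs. apply Nab.
  assert (K := nbhd2_conn Gm n S r h n1 nilp S1 Sinv Hr Sh hh1 s).
  eapply rt_trans; [exact (K a Ss Hs Na)|].
  apply conn_sym. exact (K b Ss Hs Nb).
Qed.
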